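(* Let $f(\alpha,x,y,a,z,\tilde r,\tilde s)$ be a seven-variable analytic function in a neighborhood of $(0,0,0,0,0,0,0)\in\mathbb{C}^7$. Then $f$ can be expanded in terms of the polynomials $\tilde L_n^{(\tilde r,\tilde s)}(\alpha,x,y,z,a)$, i.e. $f(\alpha,x,y,a,z,\tilde r,\tilde s)=\sum_{n=0}^\infty \mu_n\,\tilde L_n^{(\tilde r,\tilde s)}(\alpha,x,y,z,a)$ near the origin with coefficients $\mu_n$ not depending on $x,y,z$, if and only if $f$ satisfies (near the origin) the $q$-difference equation $$\begin{aligned} &(x-q^{-1}y)\Big\{f(\alpha,x,y,a,z,\tilde r,\tilde s)-f(\alpha,x,y,a,q^2z,\tilde r,\tilde s)\Big\}\\ &\quad= q^{\alpha-\tilde s}z\Big\{f(\alpha,x,q^{-1}y,a,zq^{\tilde r-\tilde s},\tilde r,\tilde s)-f(\alpha,qx,y,a,zq^{\tilde r-\tilde s},\tilde r,\tilde s)\Big\}\\ &\qquad+q^{-\tilde s}(1-aq^{\alpha})z\Big\{f(\alpha,x,q^{-1}y,a,zq^{1+\tilde r-\tilde s},\tilde r,\tilde s)-f(\alpha,qx,y,a,zq^{1+\tilde r-\tilde s},\tilde r,\tilde s)\Big\}\\ &\qquad-azq^{-\tilde s}\Big\{f(\alpha,x,q^{-1}y,a,zq^{2+\tilde r-\tilde s},\tilde r,\tilde s)-f(\alpha,qx,y,a,zq^{2+\tilde r-\tilde s},\tilde r,\tilde s)\Big\}. \end{aligned}$$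
   Context: Throughout, $q$ is a fixed nonzero real or complex number with $|q|<1$, and powers $q^{\lambda}$ ($\lambda\in\mathbb{C}$) are taken with a fixed choice of $\log q$. Notation: $(a;q)_0=1$, $(a;q)_n=\prod_{k=0}^{n-1}(1-aq^k)$. $q$-binomial coefficients: for $\alpha\in\mathbb{C}$ and integers $k\ge 0$, $$\begin{bmatrix}\alpha\\k\end{bmatrix}_q=\frac{(q^{-\alpha};q)_k}{(q;q)_k}(-1)^kq^{\alpha k-\binom k2},\qquad \begin{bmatrix}\alpha\\k\end{bmatrix}_{-q}=\frac{(-q^{-\alpha};q)_k}{(-q;q)_k}q^{\alpha k-\binom k2}.$$ Cauchy polynomials: $p_n(x,y)=(x-y)(x-qy)\cdots(x-q^{n-1}y)$, $p_0=1$. Generalized $q$-polynomials: $$\tilde L_n^{(\tilde r,\tilde s)}(\alpha,x,y,z,a)=\sum_{k=0}^n\begin{bmatrix}n\\k\end{bmatrix}_q\begin{bmatrix}\alpha\\k\end{bmatrix}_{-q}q^{\tilde r\binom k2-\tilde s\binom{k+1}2+\binom k2}(a;q)_k\,p_{n-k}(x,y)\,z^k.$$ (The same formula is used for complex $\tilde r,\tilde s$ near $0$.) *)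

(* Defs.v *)
From HB Require Import structures.
From mathcomp Require Import all_boot all_order all_algebra complex.
From mathcomp Require Import showcase.summability.
From mathcomp Require Import all_classical all_reals all_analysis.
Set Implicit Arguments.
Unset Strict Implicit.
Unset Printing Implicit Defensive.
Import Order.TTheory GRing.Theory Num.Theory numFieldNormedType.Exports.
Local Open Scope classical_set_scope.
Local Open Scope ring_scope.

Section ComplexPower.
Variable R : realType.

Definition cexp (z : R[i]) : R[i] :=
  ((expR (complex.Re z))%:C *
   (cos (complex.Im z) +i* sin (complex.Im z)))%C.

(* q ^ lambda for the determination of log q given by logq. *)
Definition cpow (logq lambda : R[i]) : R[i] := cexp (lambda * logq).

End ComplexPower.

Section Analyticity.
Variable K : numFieldType.

Definition monomial n (w : 'rV[K]_n) (m : {ffun 'I_n -> nat}) : K :=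
  \prod_(i < n) w 0 i ^+ m i.

(* Near w0, f is the sum of a power series in n variables; the sum over the
   multi-indices is unordered, that is, the limit of the finite partial sums
   along the directed family of finite sets of multi-indices. *)
Definition analytic_at n (f : 'rV[K]_n -> K) (w0 : 'rV[K]_n) : Prop :=
  exists c : {ffun 'I_n -> nat} -> K,
    \forall w \near w0,
      partial_sum (fun m => c m * monomial (w - w0) m) @ totally --> f w.

Definition uncurry7 T (g : K -> K -> K -> K -> K -> K -> K -> T)
    (w : 'rV[K]_7) : T :=
  g (w 0 0) (w 0 1) (w 0 2) (w 0 3) (w 0 4) (w 0 5) (w 0 6).

Definition near_origin (P : K -> K -> K -> K -> K -> K -> K -> Prop) : Prop :=
  \forall w \near (0 : 'rV[K]_7), uncurry7 P w.

Definition analytic_near_origin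
    (f : K -> K -> K -> K -> K -> K -> K -> K) : Prop :=
  \forall w \near (0 : 'rV[K]_7), analytic_at (uncurry7 f) w.

End Analyticity.

(* The map powq stands for lambda |-> q ^ lambda. *)
Section QPolynomials.
Variables (K : numFieldType) (q : K) (powq : K -> K).

Definition qpoch (a : K) (n : nat) : K := \prod_(k < n) (1 - a * q ^+ k).

Definition qbinom (alpha : K) (k : nat) : K :=
  qpoch (powq (- alpha)) k / qpoch q k * (-1) ^+ k
  * powq (alpha * k%:R - 'C(k, 2)%:R).

(* The binomial coefficient with subscript -q; both shifted factorials still
   have base q. *)
Definition qbinomN (alpha : K) (k : nat) : K :=
  qpoch (- powq (- alpha)) k / qpoch (- q) k
  * powq (alpha * k%:R - 'C(k, 2)%:R).

Definition cauchy_poly (n : nat) (x y : K) : K :=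
  \prod_(k < n) (x - q ^+ k * y).

Definition Ltilde (r s : K) (n : nat) (alpha x y z a : K) : K :=
  \sum_(k < n.+1)
    qbinom n%:R k * qbinomN alpha k
    * powq (r * 'C(k, 2)%:R - s * 'C(k.+1, 2)%:R + 'C(k, 2)%:R)
    * qpoch a k * cauchy_poly (n - k) x y * z ^+ k.

Definition Ltilde_expansion
    (mu : nat -> K -> K -> K -> K -> K)
    (f : K -> K -> K -> K -> K -> K -> K -> K)
    (alpha x y a z r s : K) : Prop :=
  series (fun n => mu n alpha a r s * Ltilde r s n alpha x y z a) @ \oo
    --> f alpha x y a z r s.

Definition qdiff_eq (f : K -> K -> K -> K -> K -> K -> K -> K)
    (alpha x y a z r s : K) : Prop :=
  (x - q^-1 * y) * (f alpha x y a z r s - f alpha x y a (q ^+ 2 * z) r s)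
  = powq (alpha - s) * z
    * (f alpha x (q^-1 * y) a (z * powq (r - s)) r s
       - f alpha (q * x) y a (z * powq (r - s)) r s)
  + powq (- s) * (1 - a * powq alpha) * z
    * (f alpha x (q^-1 * y) a (z * powq (1 + r - s)) r s
       - f alpha (q * x) y a (z * powq (1 + r - s)) r s)
  - a * z * powq (- s)
    * (f alpha x (q^-1 * y) a (z * powq (2 + r - s)) r s
       - f alpha (q * x) y a (z * powq (2 + r - s)) r s).

End QPolynomials.

(* Main.v *)
Require Import Defs.
From HB Require Import structures.
From mathcomp Require Import all_boot all_order all_algebra complex.
From mathcomp Require Import finmap showcase.summability.
From mathcomp Require Import all_classical all_reals all_analysis.
From mathcomp Require Import ring zify.
Set Implicit Arguments.
Unset Strict Implicit.
Unset Printing Implicit Defensive.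
Import Order.TTheory GRing.Theory Num.Theory numFieldNormedType.Exports.
Local Open Scope ring_scope.

(* Fix alpha, a, r, s and regard f as a function of (x, y, z).  Each Ltilde n is
   homogeneous of degree n in (x, y, z) and satisfies the equation, so any
   pointwise expansion does too.  Conversely the equation is homogeneous of
   degree 1, hence holds for the degree-n part of the power series of f.  Write
   this part as the sum over k of B_k(x, y) z^k: the equation determines
   B_k(x, q^-1 y) - B_k(qx, y) from B_(k+1), and a homogeneous h of positive
   degree with h(x, q^-1 y) = h(qx, y) vanishes because h = q^deg(h) h.
   Descending from the constant B_n, every B_k is a multiple of the Cauchy
   polynomial p_(n-k), with the ratios of the coefficients of Ltilde n.  Thus
   the expansion is just the regrouping of the power series of f by degree, and
   no growth estimate on Ltilde n is needed. *)

(** * The q-difference operator *)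

Section QDifferenceAlgebra.
Variables (K : numFieldType) (q : K) (powq : K -> K).
Hypotheses (q_neq0 : q != 0) (q_lt1 : `|q| < 1).
Hypotheses (powqD : {morph powq : u v / u + v >-> u * v}) (powq1 : powq 1 = q).

Lemma powq0 : powq 0 = 1.
Proof.
by apply: (mulIf q_neq0); rewrite mul1r -[X in _ * X]powq1 -powqD add0r.
Qed.

Lemma powq_neq0 u : powq u != 0.
Proof.
apply/eqP => u0; have := powqD u (- u).
by rewrite subrr powq0 u0 mul0r => /eqP; rewrite oner_eq0.
Qed.

Lemma powqN u : powq (- u) = (powq u)^-1.
Proof.
by apply: (mulfI (powq_neq0 u)); rewrite -powqD subrr powq0 mulfV ?powq_neq0.
Qed.

Lemma powqMn u n : powq (u * n%:R) = powq u ^+ n.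
Proof.
elim: n => [|n IHn]; first by rewrite mulr0 powq0 expr0.
by rewrite -natr1 mulrDr mulr1 powqD IHn exprSr.
Qed.

Lemma powq_nat n : powq n%:R = q ^+ n.
Proof. by rewrite -[n%:R]mul1r powqMn powq1. Qed.

Lemma expq_neq1 n : q ^+ n.+1 != 1.
Proof.
apply/eqP => /(congr1 Num.norm); rewrite normrX normr1 => qn1.
by have := exprn_ilt1 n.+1 (normr_ge0 q) q_lt1; rewrite qn1 ltxx.
Qed.

Lemma subr1_expq_neq0 n : 1 - q ^+ n.+1 != 0.
Proof. by rewrite subr_eq0 eq_sym expq_neq1. Qed.

(** [1 + q ^+ n.+1] divides 1 - q^(2n+2), which is nonzero. *)
Lemma addr1_expq_neq0 n : 1 + q ^+ n.+1 != 0.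
Proof.
apply: contraNneq (subr1_expq_neq0 (n.+1 + n)) => qn.
rewrite -addnS exprD (_ : 1 - _ = (1 - q ^+ n.+1) * (1 + q ^+ n.+1));
  last by ring.
by rewrite qn mulr0.
Qed.

Lemma cauchy_poly10 m : cauchy_poly q m 1 0 = 1.
Proof. by rewrite /cauchy_poly big1 // => k _; rewrite mulr0 subr0. Qed.

Lemma cauchy_poly_homogeneous m t x y :
  cauchy_poly q m (t * x) (t * y) = t ^+ m * cauchy_poly q m x y.
Proof.
rewrite /cauchy_poly -[m in t ^+ m]card_ord -prodr_const -big_split /=.
by apply: eq_bigr => k _; ring.
Qed.

(** Both products are multiples of p_(m-1)(x, y): the first by x - q^-1 y, the second by q^m (x -
    q^-1 y). At m = 0 both sides vanish. *)
Lemma cauchy_poly_diff m x y :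
  cauchy_poly q m x (q^-1 * y) - cauchy_poly q m (q * x) y
  = (1 - q ^+ m) * (x - q^-1 * y) * cauchy_poly q m.-1 x y.
Proof.
case: m => [|m]; first by rewrite /cauchy_poly !big_ord0 expr0 !subrr !mul0r.
rewrite /cauchy_poly !big_ord_recl /= expr0 !mul1r.
under eq_bigr => k _ do rewrite /bump /= add1n exprSr -mulrA mulVKf //.
under [X in _ - _ * X]eq_bigr => k _ do
  rewrite /bump /= add1n exprS -mulrA -mulrBr.
rewrite big_split /= prodr_const card_ord.
have -> : q * x - y = q * (x - q^-1 * y) by rewrite mulrBr mulVKf.
by rewrite exprS; ring.
Qed.

(** Left side minus right side of the equation with the parameters frozen: solutions form the kernel
    of an operator linear in [g]. *)
Definition qdiff_defect (alpha a r s : K) (g : K -> K -> K -> K) (x y z : K) :=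
  (x - q^-1 * y) * (g x y z - g x y (q ^+ 2 * z))
  - (powq (alpha - s) * z
     * (g x (q^-1 * y) (z * powq (r - s)) - g (q * x) y (z * powq (r - s)))
  + powq (- s) * (1 - a * powq alpha) * z
    * (g x (q^-1 * y) (z * powq (1 + r - s))
       - g (q * x) y (z * powq (1 + r - s)))
  - a * z * powq (- s)
    * (g x (q^-1 * y) (z * powq (2 + r - s))
       - g (q * x) y (z * powq (2 + r - s)))).

Lemma qdiff_eqP f alpha x y a z r s :
  qdiff_eq q powq f alpha x y a z r s <->
  qdiff_defect alpha a r s (fun x y z => f alpha x y a z r s) x y z = 0.
Proof.
rewrite /qdiff_eq /qdiff_defect; split=> [->|/eqP]; first by rewrite subrr.
by rewrite subr_eq0 => /eqP.
Qed.

(** On z^k the three terms on the right carry the weights q^alpha, (1 - a q^alpha) q^k and - a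
    q^(2k), whose sum factors as (q^alpha + q^k)(1 - a q^k). *)
Definition step_coef (alpha a r s : K) (k : nat) : K :=
  powq (- s) * powq (r - s) ^+ k * (powq alpha + q ^+ k) * (1 - a * q ^+ k).

Lemma qdiff_defect_sum alpha a r s n (g : 'I_n -> K -> K -> K -> K) x y z :
  qdiff_defect alpha a r s (fun x y z => \sum_i g i x y z) x y z =
  \sum_i qdiff_defect alpha a r s (g i) x y z.
Proof.
rewrite /qdiff_defect; rewrite !(big_split, sumrN, =^~ mulr_sumr) /=.
by rewrite ?mulr_sumr.
Qed.

Lemma qdiff_defectZ alpha a r s c g x y z :
  qdiff_defect alpha a r s (fun x y z => c * g x y z) x y z =
  c * qdiff_defect alpha a r s g x y z.
Proof. by rewrite /qdiff_defect; ring. Qed.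

Lemma qdiff_defect_monomial alpha a r s (b : K -> K -> K) k x y z :
  qdiff_defect alpha a r s (fun x y z => b x y * z ^+ k) x y z =
  (x - q^-1 * y) * (1 - q ^+ (k + k)) * b x y * z ^+ k
  - step_coef alpha a r s k * (b x (q^-1 * y) - b (q * x) y) * z ^+ k.+1.
Proof.
have -> : 1 - q ^+ (k + k) = 1 - (q ^+ 2) ^+ k by rewrite -exprM mul2n addnn.
have p1 : powq (1 + r - s) = q * powq (r - s) by rewrite -addrA (powqD 1) powq1.
have p2 : powq (2 + r - s) = q ^+ 2 * powq (r - s).
  by rewrite -addrA (powqD 2) powq_nat.
rewrite /qdiff_defect /step_coef p1 p2 powqD !exprMn exprS.
ring.
Qed.

(** * The coefficient recurrence of the generalized q-polynomials *)

Definition Ltilde_coef (r s : K) n (alpha a : K) k :=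
  qbinom q powq n%:R k * qbinomN q powq alpha k
  * powq (r * 'C(k, 2)%:R - s * 'C(k.+1, 2)%:R + 'C(k, 2)%:R) * qpoch q a k.

Lemma Ltilde_coef0 r s n alpha a : Ltilde_coef r s n alpha a 0 = 1.
Proof.
rewrite /Ltilde_coef /qbinom /qbinomN /qpoch !big_ord0 !bin0n !bin_small //.
by rewrite !mulr0 !subrr addr0 powq0 expr0 !divr1 !mulr1.
Qed.

(** From k to k+1 the binomials gain (1 - q^(n-k))/(1 - q^(k+1)) and (q^alpha + q^k) q^(-k)/(1 +
    q^(k+1)), the power of q gains q^((r-s)k - s + k), and (a; q)_k gains 1 - a q^k. *)
Lemma Ltilde_coefS r s n alpha a k : (k <= n)%N ->
  Ltilde_coef r s n alpha a k.+1 * (1 - q ^+ (k.+1 + k.+1)) =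
  Ltilde_coef r s n alpha a k * (1 - q ^+ (n - k)) * step_coef alpha a r s k.
Proof.
move=> le_kn; have q1 := subr1_expq_neq0 k; have q2 := addr1_expq_neq0 k.
have -> : 1 - q ^+ (k.+1 + k.+1) = (1 - q ^+ k.+1) * (1 + q ^+ k.+1).
  by rewrite exprD; ring.
have qn u v : powq (u - v) = powq u / powq v by rewrite powqD powqN.
have Ck m : powq (m%:R * k.+1%:R) = powq (m%:R * k%:R) * q ^+ m.
  by rewrite -[k.+1%:R]natr1 mulrDr mulr1 powqD powq_nat.
have Ca : powq (alpha * k.+1%:R) = powq (alpha * k%:R) * powq alpha.
  by rewrite -[k.+1%:R]natr1 mulrDr mulr1 powqD.
have C2 : powq 'C(k.+1, 2)%:R = powq 'C(k, 2)%:R * q ^+ k.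
  by rewrite binS bin1 natrD powqD (powq_nat k).
have Cr : powq (r * 'C(k.+1, 2)%:R) = powq (r * 'C(k, 2)%:R) * powq r ^+ k.
  by rewrite binS bin1 natrD mulrDr powqD (powqMn r k).
have Cs : powq (s * 'C(k.+2, 2)%:R) =
    powq (s * 'C(k.+1, 2)%:R) * powq s ^+ k.+1.
  by rewrite binS bin1 natrD mulrDr powqD (powqMn s k.+1).
rewrite /Ltilde_coef /qbinom /qbinomN /step_coef /qpoch !big_ord_recr /=.
rewrite !qn !(powqD (_ - _)) !qn Ck Ca C2 Cr Cs !powqN powq_nat.
rewrite -[in q ^+ n](subnK le_kn) exprD.
set N := q ^+ (n - k).
have Nn0 : N != 0 by rewrite expf_neq0.
have Q0 : q ^+ k != 0 by rewrite expf_neq0.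
rewrite !invfM !mulNr !opprK -!exprS.
set P1 := \prod_(i < k) _; set P2 := \prod_(i < k) _.
set P3 := \prod_(i < k) _; set P4 := \prod_(i < k) _.
set P5 := \prod_(i < k) _.
have P2n : P2 != 0.
  by apply/prodf_neq0 => i _; rewrite -exprS subr1_expq_neq0.
have P4n : P4 != 0.
  by apply/prodf_neq0 => i _; rewrite mulNr opprK -exprS addr1_expq_neq0.
rewrite !exprMn !exprVn [(-1) ^+ k.+1]exprS [powq s ^+ k.+1]exprS.
have s0 := powq_neq0 s; have a0 := powq_neq0 alpha.
have c0 := powq_neq0 'C(k, 2)%:R; have d0 := powq_neq0 (s * 'C(k.+1, 2)%:R).
have sk0 : powq s ^+ k != 0 by rewrite expf_neq0.
by field; rewrite P2n P4n Nn0 Q0 q1 q2 s0 a0 c0 d0 sk0.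
Qed.

(** Sorted by powers of z, the constant term drops out since 1 - q^0 = 0, and the term in z^(n+1) by
    the hypothesis on [B n]. *)
Lemma qdiff_defect_zpoly alpha a r s n (B : nat -> K -> K -> K) x y z :
  (forall x y, B n x (q^-1 * y) = B n (q * x) y) ->
  qdiff_defect alpha a r s (fun x y z => \sum_(k < n.+1) B k x y * z ^+ k) x y z
  = \sum_(k < n)
      ((x - q^-1 * y) * (1 - q ^+ (k.+1 + k.+1)) * B k.+1 x y
       - step_coef alpha a r s k * (B k x (q^-1 * y) - B k (q * x) y))
      * z ^+ k.+1.
Proof.
move=> Bn; rewrite qdiff_defect_sum.
under eq_bigr => k _ do rewrite qdiff_defect_monomial.
rewrite sumrB big_ord_recl big_ord_recr /= Bn !subrr !(mulr0, mul0r).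
rewrite add0r addr0.
by rewrite -sumrB; apply: eq_bigr => k _; rewrite [RHS]mulrBl.
Qed.

Lemma qdiff_defect_Ltilde alpha a r s n x y z :
  qdiff_defect alpha a r s
    (fun x y z => Ltilde q powq r s n alpha x y z a) x y z = 0.
Proof.
rewrite [LHS](@qdiff_defect_zpoly _ _ _ _ n
  (fun k x y => Ltilde_coef r s n alpha a k * cauchy_poly q (n - k) x y)).
  apply: big1 => k _.
  (* The difference of Cauchy polynomials yields (1 - q^(n-k))(x - q^-1 y) p_(n-k-1), so the
     coefficient of z^(k+1) is a multiple of the recurrence. *)
  rewrite -mulrBr cauchy_poly_diff -subnS.
  have := @Ltilde_coefS r s n alpha a k (ltnW (ltn_ord k)).
  set p := cauchy_poly _ _ _ _ => E.
  rewrite (_ : _ - _ = (x - q^-1 * y) * p *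
    (Ltilde_coef r s n alpha a k.+1 * (1 - q ^+ (k.+1 + k.+1)) -
     Ltilde_coef r s n alpha a k * (1 - q ^+ (n - k))
     * step_coef alpha a r s k)).
    by rewrite E subrr mulr0 mul0r.
  by ring.
by move=> {}x {}y; rewrite subnn /cauchy_poly !big_ord0.
Qed.

(** * Homogeneous solutions of the equation *)

Lemma homogeneous_qdiff_eq0 m (h : K -> K -> K) :
  (forall t x y, h (t * x) (t * y) = t ^+ m.+1 * h x y) ->
  (forall x y, h x (q^-1 * y) = h (q * x) y) ->
  forall x y, h x y = 0.
Proof.
move=> hom hq x y; apply: (mulfI (subr1_expq_neq0 m)).
by rewrite mulr0 mulrBl mul1r -hom -hq mulKf // subrr.
Qed.

(** When no [step_coef] vanishes, the solution of degree n is unique up to a scalar, which is read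
    off at (1, 0, 0), where [Ltilde] equals 1. *)
Lemma qdiff_eq_homogeneous alpha a r s n (B : nat -> K -> K -> K) :
  (forall k, step_coef alpha a r s k != 0) ->
  (forall k t x y, (k <= n)%N ->
    B k (t * x) (t * y) = t ^+ (n - k) * B k x y) ->
  (forall x y, B n x y = B n 1 0) ->
  (forall x y z, qdiff_defect alpha a r s
     (fun x y z => \sum_(k < n.+1) B k x y * z ^+ k) x y z = 0) ->
  forall x y z, \sum_(k < n.+1) B k x y * z ^+ k
    = B 0 1 0 * Ltilde q powq r s n alpha x y z a.
Proof.
move=> step_neq0 hom Bn defect0.
have rec k x y : (k < n)%N ->
    (x - q^-1 * y) * (1 - q ^+ (k.+1 + k.+1)) * B k.+1 x y
    = step_coef alpha a r s k * (B k x (q^-1 * y) - B k (q * x) y).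
  move=> ltkn.
  pose c k := (x - q^-1 * y) * (1 - q ^+ (k.+1 + k.+1)) * B k.+1 x y
    - step_coef alpha a r s k * (B k x (q^-1 * y) - B k (q * x) y).
  suff : c k = 0 by move/eqP; rewrite subr_eq0 => /eqP.
  (* For fixed x and y the defect is z times a polynomial in z of size at most n. At the distinct
     nonzero points 1, ..., n the factor z cancels, and n roots force all coefficients to vanish. *)
  pose P := \poly_(i < n) c i.
  suff P0 : P = 0.
    by have : P`_k = 0 by [rewrite P0 coef0]; rewrite coef_poly ltkn.
  apply/eqP/negPn/negP => Pn0.
  have := @max_poly_roots _ P [seq i.+1%:R | i <- iota 0 n] Pn0.
  rewrite size_map size_iota ltnNge size_poly => impF.
  suff : false by [].
  apply: impF.
    apply/allP => _ /mapP[i _ ->]; rewrite rootE horner_poly.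
    have := defect0 x y i.+1%:R; rewrite qdiff_defect_zpoly; last first.
      by move=> ? ?; rewrite Bn [RHS]Bn.
    under eq_bigr do rewrite -/(c _) exprSr mulrA.
    by rewrite -mulr_suml => /eqP; rewrite mulf_eq0 pnatr_eq0 orbF.
  rewrite map_inj_uniq ?iota_uniq // => i j /eqP.
  by rewrite eqr_nat eqSS => /eqP.
have BP k : (k <= n)%N ->
    forall x y, B k x y = B k 1 0 * cauchy_poly q (n - k) x y.
  move=> lekn; have := subnKC lekn.
  (* Descending induction on k, carried by m = n - k. *)
  move: {1}(n - k)%N => m; elim: m k {lekn} => [|m IHm] i.
    by rewrite addn0 => -> x y; rewrite subnn Bn /cauchy_poly big_ord0 mulr1.
  move=> im; have nim : (n - i = m.+1)%N by rewrite -im addKn.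
  have ltin : (i < n)%N by rewrite -subn_gt0 nim.
  have {}IHm := IHm i.+1 _; rewrite addSnnS im subnS nim /= in IHm.
  (* With this [b], the polynomial b p_(m+1) has the q-difference that [rec] imposes on [B i]; what
     remains is homogeneous of degree m+1 with zero q-difference, hence zero. *)
  pose b := B i.+1 1 0 * (1 - q ^+ (i.+1 + i.+1))
            / (step_coef alpha a r s i * (1 - q ^+ m.+1)).
  have h0 := @homogeneous_qdiff_eq0 m
    (fun x y => B i x y - b * cauchy_poly q m.+1 x y) _ _.
  have {}h0 u v : B i u v = b * cauchy_poly q m.+1 u v.
    apply/eqP; rewrite -subr_eq0; apply/eqP/h0 => [t|] {}x {}y.
      rewrite hom ?(ltnW ltin) // nim cauchy_poly_homogeneous.
      by ring.
    apply/eqP; rewrite -subr_eq0; apply/eqP.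
    apply: (mulfI (step_neq0 i)); rewrite mulr0.
    rewrite [LHS](_ : _ =
       step_coef alpha a r s i * (B i x (q^-1 * y) - B i (q * x) y)
       - step_coef alpha a r s i * b *
       (cauchy_poly q m.+1 x (q^-1 * y) - cauchy_poly q m.+1 (q * x) y));
      last by ring.
    rewrite -rec // IHm // cauchy_poly_diff /= /b.
    by field; rewrite q_neq0 step_neq0 subr1_expq_neq0.
  by move=> x y; rewrite nim !h0 cauchy_poly10 mulr1.
have coefP k : (k <= n)%N -> B k 1 0 = B 0 1 0 * Ltilde_coef r s n alpha a k.
  elim: k => [_|k IHk ltkn]; first by rewrite Ltilde_coef0 mulr1.
  apply: (mulIf (subr1_expq_neq0 (k + k.+1))); rewrite -addSn -mulrA.
  rewrite Ltilde_coefS ?(ltnW ltkn) //.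
  (* At (1, 0) the factor x - q^-1 y and the Cauchy polynomials equal 1, and the relation becomes
     the recurrence of [Ltilde_coef]. *)
  have := rec k 1 0 ltkn; have lekn := ltnW ltkn.
  rewrite (BP k lekn 1 (_ * _)) (BP k lekn (_ * _)).
  rewrite -mulrBr cauchy_poly_diff cauchy_poly10 mulr0 subr0 mul1r mulrC => ->.
  by rewrite IHk ?(ltnW ltkn) //; ring.
move=> x y z; rewrite /Ltilde mulr_sumr; apply: eq_bigr => k _.
have lekn : (k <= n)%N by rewrite -ltnS.
by rewrite (BP k lekn x y) (coefP k lekn) /Ltilde_coef !mulrA.
Qed.
End QDifferenceAlgebra.

(** * Power series and unordered sums *)

Section PowerSeries.
Variable K : numFieldType.
Local Open Scope classical_set_scope.

Lemma tail_le_geometric (b : nat -> K) (C tau : K) m n :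
  0 <= tau -> tau *+ 2 <= 1 -> 0 <= C -> (forall i, `|b i| <= C) ->
  `|\sum_(m.+1 <= i < n) b i * tau ^+ i| <= C * tau ^+ m.+1 *+ 2.
Proof.
move=> tau0 tau1 C0 bC.
have pos i : 0 <= C * tau ^+ i *+ 2.
  by rewrite mulrn_wge0 // mulr_ge0 // exprn_ge0.
have [lemn|ltnm] := leqP m.+1 n; last by rewrite big_geq ?normr0 ?pos // ltnW.
(* The sharper bound makes the induction telescope: as 2 tau <= 1, C tau^i is at most 2C tau^i - 2C
   tau^(i+1). *)
apply: (@le_trans _ _ (C * tau ^+ m.+1 *+ 2 - C * tau ^+ n *+ 2)); last first.
  by rewrite gerBl.
rewrite -(subnKC lemn); elim: (n - _)%N => [|d IHd].
  by rewrite addn0 big_geq // normr0 subrr.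
rewrite addnS big_nat_recr ?leq_addr //= (le_trans (ler_normD _ _)) //.
apply: (le_trans (lerD IHd (_ : _ <= C * tau ^+ (m.+1 + d)))).
  by rewrite normrM [ `|tau ^+ _|]ger0_norm ?exprn_ge0 // ler_wpM2r ?exprn_ge0.
rewrite -addrA lerD2l mulr2n opprD -addrA addNr addr0 lerN2 exprSr mulrA.
by rewrite -mulrnAr ler_piMr // mulr_ge0 ?exprn_ge0.
Qed.

(** Once the lower coefficients vanish, a_m t^m is balanced by a tail of order t^(m+1), so a_m is
    arbitrarily small. The point t = 0 is excluded because the application divides by t. *)
Lemma power_series_eq0 (a : nat -> K) (e : K) : 0 < e ->
  (forall t, t != 0 -> `|t| < e ->
     series (fun n => a n * t ^+ n) @ \oo --> 0) ->
  forall n, a n = 0.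
Proof.
move=> e0 cva; elim/ltn_ind => m IHm.
pose t0 := e / 2.
have t00 : 0 < t0 by rewrite divr_gt0.
have t0e : `|t0| < e by rewrite gtr0_norm // ltr_pdivrMr // ltr_pMr // ltr1n.
have [C C0 tC] : exists2 C : K, 0 <= C & forall i, `|a i * t0 ^+ i| <= C.
  have cv0 := cvgP _ (cva t0 (lt0r_neq0 t00) t0e).
  have [M [_ /(_ (M + 1))/(_ _)/= SM]] := cvg_seq_bounded cv0.
  have {}SM := SM (ltr_pwDr ltr01 (lexx M)).
  have M0 : 0 <= M + 1 by apply: le_trans (SM 0%N I).
  exists ((M + 1) *+ 2) => [|i]; first by rewrite mulrn_wge0.
  have := ler_normB (series (fun n => a n * t0 ^+ n) i.+1)
                    (series (fun n => a n * t0 ^+ n) i).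
  rewrite seriesSB => /le_trans; apply.
  by rewrite mulr2n lerD // SM.
suff : `|a m| * t0 ^+ m <= 0.
  by rewrite pmulr_lle0 ?exprn_gt0 // normr_le0 => /eqP.
apply/ler_addgt0Pr => eps eps0; rewrite add0r.
(* This [D] makes tau = eps / D satisfy both 2 tau <= 1 and 2 C tau <= eps. *)
pose D := eps *+ 2 + (C *+ 2 + 1).
have C1 : 0 < C *+ 2 + 1 by rewrite ltr_wpDl // mulrn_wge0.
have D0 : 0 < D by rewrite addr_gt0 // pmulrn_lgt0.
pose tau : K := eps / D.
have tau0 : 0 < tau by rewrite divr_gt0.
have tau2 : tau *+ 2 <= 1.
  by rewrite -mulrnAl ler_pdivrMr // mul1r lerDl ltW.
have tau1 : tau <= 1 by rewrite (le_trans _ tau2) // mulr2n lerDl ltW.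
have tauC : C * tau *+ 2 <= eps.
  rewrite mulrCA -mulrnAr -[leRHS]mulr1 ler_wpM2l ?ltW // -mulrnAl.
  rewrite ltr_pdivrMr // mul1r /D addrCA ltr_pwDr ?addr_gt0 // pmulrn_lgt0.
have tail : `|a m * (tau * t0) ^+ m| <= C * tau ^+ m.+1 *+ 2.
  apply/ler_addgt0Pr => d d0.
  have /cvgrPdist_lt/(_ d d0)[N _ SN] :
      series (fun n => a n * (tau * t0) ^+ n) @ \oo --> 0.
    apply: cva; first by rewrite mulf_neq0 ?gt_eqF.
    by rewrite normrM (le_lt_trans _ t0e) // ler_piMl // gtr0_norm.
  have := SN (N + m.+1)%N (leq_addr _ _).
  rewrite /= sub0r normrN /series /= => /ltW le_d.
  have le_tail := @tail_le_geometric (fun i => a i * t0 ^+ i) C tau m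
    (N + m.+1)%N (ltW tau0) tau2 C0 tC.
  rewrite addrC -[X in `|X|](addrK (\sum_(m.+1 <= i < N + m.+1)
    a i * t0 ^+ i * tau ^+ i)).
  apply: le_trans (ler_normB _ _) (lerD _ le_tail); apply: le_trans le_d.
  rewrite [in leRHS](@big_cat_nat _ _ _ m.+1) ?leq_addl //=.
  rewrite [X in _ <= `|X + _|]big_nat_recr //=.
  rewrite [X in `|X + _ + _|]big1_seq ?add0r.
    by under eq_bigr do rewrite -mulrA [t0 ^+ _ * _]mulrC -exprMn.
  by move=> i; rewrite mem_index_iota => /andP[_ ?]; rewrite IHm ?mul0r.
rewrite -(ler_pM2r (exprn_gt0 m tau0)).
apply: le_trans (_ : C * tau ^+ m.+1 *+ 2 <= _).
  rewrite (le_trans _ tail) // normrM normrX (gtr0_norm (mulr_gt0 _ _)) //.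
  by rewrite -mulrA -exprMn [t0 * _]mulrC.
by rewrite exprS mulrA -mulrnAl ler_wpM2r // exprn_ge0 // ltW.
Qed.
End PowerSeries.

Section UnorderedSums.
Variables (K : numFieldType) (I : choiceType).
Implicit Types (u v : I -> K) (l : K).
Local Open Scope classical_set_scope.
Local Open Scope fset_scope.
#[local] Existing Instance totally_filter.

Lemma unordered_cvgP u l : partial_sum u @ totally --> l <->
  forall e, 0 < e -> exists A : {fset I}, forall B : {fset I}, A `<=` B ->
    `|l - \sum_(i <- B) u i| < e.
Proof.
rewrite cvgrPdist_lt; split=> ul e e0.
  have [A _ AP] := ul e e0; exists A => B AB.
  by have := AP B AB; rewrite /partial_sum big_seq_fsetE.
have [A AP] := ul e e0; exists A => // B /= AB.
by have := AP B AB; rewrite /partial_sum big_seq_fsetE.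
Qed.

Lemma eq_unordered_cvg u v l : u =1 v ->
  partial_sum u @ totally --> l -> partial_sum v @ totally --> l.
Proof. by move/funext ->. Qed.

Lemma unordered_cvgZ c u l : partial_sum u @ totally --> l ->
  partial_sum (fun i => c * u i) @ totally --> c * l.
Proof.
move=> ul; rewrite (_ : partial_sum _ = fun A => c * partial_sum u A).
  exact: cvgMr.
by apply/funext => A; rewrite /partial_sum mulr_sumr.
Qed.

Lemma unordered_cvg_sum (J : Type) (r : seq J) (u : J -> I -> K) (l : J -> K) :
  (forall j, partial_sum (u j) @ totally --> l j) ->
  partial_sum (fun i => \sum_(j <- r) u j i) @ totally --> \sum_(j <- r) l j.
Proof.
move=> ul.
rewrite (_ : partial_sum _ = fun A => \sum_(j <- r) partial_sum (u j) A).
  by apply: cvg_big => //; exact: add_continuous.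
by apply/funext => A; rewrite /partial_sum exchange_big.
Qed.

Lemma sum_fsub u (A B : {fset I}) : A `<=` B ->
  \sum_(i <- A) u i = \sum_(i <- B) u i *+ (i \in A).
Proof.
move=> AB; rewrite -(big_fset_incl _ AB) => [|i _ /negPf->] //.
by apply: eq_big_seq => i ->.
Qed.

(** Adding to [A] the members of [B] in [G] changes the full sum exactly as passing from [A] to [B]
    changes the sum over [G]. *)
Lemma unordered_cvg_subfamily_cauchy u l (G : pred I) e :
  partial_sum u @ totally --> l -> 0 < e ->
  exists A : {fset I}, forall B : {fset I}, A `<=` B ->
    `|\sum_(i <- A) u i *+ G i - \sum_(i <- B) u i *+ G i| < e.
Proof.
move=> /unordered_cvgP ul e0.
have [A AP] := ul (e / 2) (divr_gt0 e0 (ltr0Sn _ 1)).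
exists A => B AB; pose C := A `|` [fset i in B | G i].
have AC : A `<=` C by rewrite fsubsetUl.
have CB : C `<=` B by rewrite fsubUset AB fset_sub.
have -> : \sum_(i <- A) u i *+ G i - \sum_(i <- B) u i *+ G i =
    (l - \sum_(i <- C) u i) - (l - \sum_(i <- A) u i).
  rewrite opprB [RHS]addrC subrKA.
  rewrite !(sum_fsub _ AB) (sum_fsub _ CB).
  rewrite -!sumrB; apply: eq_big_seq => i iB.
  rewrite !inE iB /=; case: (i \in A); case: (G i);
    by rewrite /= ?mulr1n ?mulr0n ?subrr.
rewrite (le_lt_trans (ler_normB _ _)) // [e]splitr ltrD ?AP //.
Qed.

(** Allows summation degree by degree, even when each degree contains infinitely many indices. *)
Lemma unordered_cvg_exhaustion u l (g : I -> nat) (S : nat -> K) :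
  partial_sum u @ totally --> l ->
  (forall n, partial_sum (fun i => u i *+ (g i < n)%N) @ totally --> S n) ->
  S @ \oo --> l.
Proof.
move=> /unordered_cvgP ul uS; apply/cvgrPdist_le => e e0.
have [A AP] := ul (e / 2) (divr_gt0 e0 (ltr0Sn _ 1)).
(* From [N] on, all of [A] satisfies g < n. So [C] below contains [A], and its sum, close to [l], is
   also the truncated sum over the union of [A] and [B], close to [S n]. *)
pose N := (\max_(i <- A) g i).+1.
exists N => // n /= leNn.
have [B BP] := (unordered_cvgP _ _).1 (uS n) (e / 2) (divr_gt0 e0 (ltr0Sn _ 1)).
pose C := [fset i in A `|` B | (g i < n)%N].
have AC : A `<=` C.
  apply/fsubsetP => i iA; rewrite !inE iA /=.
  by rewrite (leq_trans _ leNn) // ltnS; apply: leq_bigmax_seq.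
have CAB : C `<=` A `|` B by rewrite fset_sub.
have eqC : \sum_(i <- C) u i = \sum_(i <- A `|` B) u i *+ (g i < n)%N.
  rewrite (sum_fsub _ CAB); apply: eq_big_seq => i; rewrite !inE => iAB.
  by rewrite iAB.
have := ltrD (AP C AC) (BP (A `|` B) (fsubsetUr _ _)).
rewrite -splitr eqC [ `|S n - _|]distrC => /ltW; apply: le_trans.
exact: ler_distD.
Qed.
End UnorderedSums.

(** * Completeness of the complex numbers *)

Section ComplexCompleteness.
Variable R : realType.
Local Open Scope classical_set_scope.

Lemma normc_le_ReDIm (z : R[i]) :
  `|z| <= (`|complex.Re z| + `|complex.Im z|)%:C%C.
Proof.
rewrite normc_def lecR -[leRHS]ger0_norm ?addr_ge0 // -sqrtr_sqr ler_wsqrtr //.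
rewrite sqrrD !real_normK ?num_real // addrAC lerDl.
by rewrite mulrn_wge0 // mulr_ge0.
Qed.

Lemma normc_ge_Im (z : R[i]) : `|complex.Im z|%:C%C <= `|z|.
Proof. by rewrite normc_def lecR -sqrtr_sqr ler_wsqrtr // lerDr sqr_ge0. Qed.

(** Re and Im are additive and bounded by the modulus, so both parts are Cauchy in R, and their
    limits combine. *)
Lemma complex_cauchy_cvg T (F : set_system T) (g : T -> R[i]) :
  ProperFilter F ->
  (forall e, 0 < e -> exists z, \forall t \near F, `|z - g t| < e) ->
  exists l, forall e, 0 < e -> \forall t \near F, `|l - g t| < e.
Proof.
move=> FF cg.
have real_part (p : R[i] -> R) : {morph p : u v / u - v} ->
    (forall z, `|p z|%:C%C <= `|z|) -> exists l : R, p \o g @ F --> l.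
  move=> pB p_le; exists (lim (p \o g @ F)).
  apply/cauchy_cvgP/cauchy_exP => e e0.
  have e0C : 0 < e%:C%C by rewrite ltcR.
  have [z gz] := cg _ e0C; exists (p z).
  apply: filterS gz => t gz; rewrite /ball /= -pB -ltcR.
  exact: le_lt_trans (p_le _) gz.
have [a ga] := real_part (@complex.Re R) (raddfB _) (@normc_ge_Re R).
have [b gb] := real_part (@complex.Im R) (raddfB _) normc_ge_Im.
exists (a +i* b)%C; move=> e e0.
have /complex_realP[d ed] : e \is Num.real by rewrite gtr0_real.
move: e0; rewrite {}ed ltcR => d0.
have d20 : 0 < d / 2 by rewrite divr_gt0.
near=> t; apply: le_lt_trans (normc_le_ReDIm _) _.
rewrite ltcR [d]splitr !raddfB /= ltrD //; near: t.
  by move/cvgrPdist_lt: ga; apply.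
by move/cvgrPdist_lt: gb; apply.
Unshelve. all: by end_near.
Qed.

End ComplexCompleteness.

Section NearOrigin.
Variable K : numFieldType.
Local Open Scope classical_set_scope.

Definition small (e : K) : pred K := fun u => `|u| < e.

(** Balls of K^7 are polydiscs. The parameters are grouped apart from x, y, z because the proof
    freezes them. *)
Lemma near_originP (P : K -> K -> K -> K -> K -> K -> K -> Prop) :
  near_origin P <-> exists2 e : K, 0 < e &
    forall alpha x y a z r s,
      [/\ small e alpha, small e a, small e r & small e s] ->
      [/\ small e x, small e y & small e z] -> P alpha x y a z r s.
Proof.
rewrite /near_origin; split=> [/nbhs_ballP[e e0 eP]|[e e0 eP]].
  exists e => // alpha x y a z r s [? ? ? ?] [? ? ?].
  have := eP (\row_j nth 0 [:: alpha; x; y; a; z; r; s] j).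
  rewrite /uncurry7 /= !mxE; apply; split=> // i j.
  rewrite /ball /= !mxE sub0r normrN.
  by case: j => -[|[|[|[|[|[|[|//]]]]]]].
apply/nbhs_ballP; exists e => // w [_ ew]; rewrite /uncurry7 /=.
have small_w j : small e (w 0 j).
  by have := ew 0 j; rewrite /ball /= mxE sub0r normrN.
by apply: eP.
Qed.
End NearOrigin.

(** * Regrouping a power series by degree in x, y, z *)

Lemma sum_mulrb_eq (V : nmodType) n (F : nat -> V) (j : nat) :
  \sum_(i < n) F i *+ (j == i) = F j *+ (j < n)%N.
Proof.
under eq_bigr do rewrite mulrb eq_sym.
by rewrite -big_mkcond big_ord1_eq mulrb.
Qed.

(** A triple (i, j, k) is met only at i' = i and k' = k, and only if its sum is n. *)
Lemma sum_mulrb_add (V : nmodType) n (v : V) (i j k : nat) :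
  \sum_(k' < n.+1) \sum_(i' < (n - k').+1)
    v *+ (j == (n - k' - i')%N) *+ (i == i') *+ (k == k')
  = v *+ (i + j + k == n)%N.
Proof.
under eq_bigr => k' _.
  rewrite sumrMnl (sum_mulrb_eq _ (fun i' => v *+ (j == (n - k' - i')%N))).
  over.
rewrite (sum_mulrb_eq _
  (fun k' => v *+ (j == (n - k' - i)%N) *+ (i < (n - k').+1)%N)).
rewrite -!mulrnA !mulnb; congr (_ *+ nat_of_bool _).
lia.
Qed.

Section Regrouping.
Variable K : numFieldType.
Local Open Scope classical_set_scope.
Local Notation exponent := {ffun 'I_7 -> nat}.

(* The only consequence of completeness that is needed. *)
Hypothesis subfamily_cvg :
  forall (u : exponent -> K) (l : K) (G : pred exponent),
  partial_sum u @ totally --> l ->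
  exists l' : K, partial_sum (fun m => u m *+ G m) @ totally --> l'.

(** [d i j k] stands for the coefficient of x^i y^j z^k at fixed parameters; this is the form B_k of
    degree n - k. *)
Definition xy_part (d : nat -> nat -> nat -> K) n k (x y : K) :=
  \sum_(i < (n - k).+1) d i (n - k - i)%N k * (x ^+ i * y ^+ (n - k - i)).

Definition xyz_part d n (x y z : K) :=
  \sum_(k < n.+1) xy_part d n k x y * z ^+ k.

Lemma analytic_regroup f : analytic_at (uncurry7 f) (0 : 'rV[K]_7) ->
  exists2 e : K, 0 < e & forall alpha a r s,
    [/\ small e alpha, small e a, small e r & small e s] ->
    exists d, forall x y z, [/\ small e x, small e y & small e z] ->
      series (fun n => xyz_part d n x y z) @ \oo --> f alpha x y a z r s.
Proof.
move=> [c cP].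
pose W (alpha x y a z r s : K) : 'rV[K]_7 :=
  \row_j nth 0 [:: alpha; x; y; a; z; r; s] j.
have /near_originP[e e0 cf] : near_origin (fun alpha x y a z r s =>
    partial_sum (fun m => c m * monomial (W alpha x y a z r s) m) @ totally
      --> f alpha x y a z r s).
  apply: filterS cP => w; rewrite subr0 /uncurry7.
  rewrite [W _ _ _ _ _ _ _](_ : _ = w) //; apply/rowP => j; rewrite !mxE.
  by case: j => -[|[|[|[|[|[|[|//]]]]]]] j7 /=; congr (w _ _); apply: val_inj.
exists e => // alpha a r s small_p.
(* Coordinates 1, 2 and 4 carry x, y and z. *)
pose j1 : 'I_7 := lift ord0 ord0.
pose j2 : 'I_7 := lift ord0 (lift ord0 ord0).
pose j4 : 'I_7 := lift ord0 (lift ord0 (lift ord0 (lift ord0 ord0))).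
pose p m := c m * monomial (W alpha 1 1 a 1 r s) m.
have pE x y z m : c m * monomial (W alpha x y a z r s) m =
    x ^+ m j1 * y ^+ m j2 * z ^+ m j4 * p m.
  rewrite /p /monomial !big_ord_recl !big_ord0 !mxE /= !expr1n !mul1r mulr1.
  by ring.
pose v (x y z : K) i j k m :=
  c m * monomial (W alpha x y a z r s) m
    *+ (m j2 == j) *+ (m j1 == i) *+ (m j4 == k).
(* The slices are first summed at x = y = z = t. As t is nonzero, division by t^(i+j+k) gives
   coefficients independent of x, y, z, and rescaling gives the slice sums at any x, y, z. *)
pose t := e / 2.
have t0 : 0 < t by rewrite divr_gt0.
have small_t : small e t.
  by rewrite /small gtr0_norm // ltr_pdivrMr // ltr_pMr // ltr1n.
have [d dP] : exists d : nat -> nat -> nat -> K, forall i j k,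
    partial_sum (v t t t i j k) @ totally --> d i j k.
  suff /choice[d dP] : forall ijk : nat * nat * nat, exists l : K,
      partial_sum (v t t t ijk.1.1 ijk.1.2 ijk.2) @ totally --> l.
    by exists (fun i j k => d (i, j, k)) => i j k; exact: (dP (i, j, k)).
  move=> [[i j] k] /=.
  have [//|l] := @subfamily_cvg _ _
    (fun m => [&& m j2 == j, m j1 == i & m j4 == k])
    (cf alpha t t a t r s small_p _).
  move=> ul; exists l; apply: eq_unordered_cvg ul => m.
  by rewrite /v -!mulrnA !mulnb.
exists (fun i j k => d i j k / t ^+ (i + j + k)) => x y z small_xyz.
have vP i j k : partial_sum (v x y z i j k) @ totally -->
    d i j k / t ^+ (i + j + k) * (x ^+ i * y ^+ j) * z ^+ k.
  have := @unordered_cvgZ _ _ (x ^+ i * y ^+ j * z ^+ k / t ^+ (i + j + k))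
    _ _ (dP i j k).
  rewrite [X in _ --> X](_ : _ =
      d i j k / t ^+ (i + j + k) * (x ^+ i * y ^+ j) * z ^+ k);
    last by ring.
  apply: eq_unordered_cvg => m; rewrite /v !pE.
  have [<-|] := eqVneq (m j2) j; last by rewrite !mulr0n !mul0rn mulr0.
  have [<-|] := eqVneq (m j1) i; last by rewrite !mulr0n !mul0rn mulr0.
  have [<-|] := eqVneq (m j4) k; last by rewrite !mulr0n mulr0.
  rewrite !mulr1n !exprD; field.
  by rewrite !expf_neq0 ?gt_eqF.
pose deg (m : exponent) := (m j1 + m j2 + m j4)%N.
apply: (unordered_cvg_exhaustion (g := deg)
  (cf _ _ _ _ _ _ _ small_p small_xyz)) => n.
rewrite [X in _ --> X](_ : _ = \sum_(n' < n) \sum_(k < n'.+1)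
  \sum_(i < (n' - k).+1) d i (n' - k - i)%N k / t ^+ (i + (n' - k - i) + k) *
    (x ^+ i * y ^+ (n' - k - i)) * z ^+ k); last first.
  rewrite /series /= big_mkord; apply: eq_bigr => n' _.
  by apply: eq_bigr => k _; rewrite mulr_suml.
(* The terms of degree below n split into finitely many slices, each of known sum. *)
apply: (@eq_unordered_cvg _ _ (fun m => \sum_(n' < n)
  \sum_(k < n'.+1) \sum_(i < (n' - k).+1) v x y z i (n' - k - i)%N k m)).
  move=> m; under [LHS]eq_bigr => n' _ do rewrite sum_mulrb_add.
  by rewrite (sum_mulrb_eq _ (fun=> _)).
by do 3! [apply: unordered_cvg_sum => ?]; exact: vP.
Qed.
End Regrouping.

(** * The expansion theorem *)

Section Expansion.
Local Open Scope classical_set_scope.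
Variables (K : numFieldType) (q : K) (powq : K -> K).
Hypotheses (q_neq0 : q != 0) (q_lt1 : `|q| < 1).
Hypotheses (powqD : {morph powq : u v / u + v >-> u * v}) (powq1 : powq 1 = q).
Hypothesis powq_near1 : forall e : K, 0 < e ->
  exists2 d, 0 < d & forall u, small d u -> small e (powq u - 1).
Hypothesis subfamily_cvg :
  forall (u : {ffun 'I_7 -> nat} -> K) (l : K) (G : pred _),
  partial_sum u @ totally --> l ->
  exists l' : K, partial_sum (fun m => u m *+ G m) @ totally --> l'.

(** The witness ab/(a + b) serves as the minimum of two radii. *)
Lemma pos_lower_bound (a b : K) : 0 < a -> 0 < b ->
  exists2 c, 0 < c & c <= a /\ c <= b.
Proof.
move=> a0 b0; have ab0 : 0 < a + b by rewrite addr_gt0.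
exists (a * b / (a + b)); first by rewrite divr_gt0 ?mulr_gt0.
split; first by rewrite -mulrA ler_piMr ?ltW // ltr_pdivrMr // mul1r ltr_pwDl.
by rewrite [a * b]mulrC -mulrA ler_piMr ?ltW // ltr_pdivrMr // mul1r ltr_pwDr.
Qed.

Lemma smallW (c e u : K) : c <= e -> small c u -> small e u.
Proof. by move=> ce /lt_le_trans; apply. Qed.

Lemma small_qM (e u : K) : small e u -> small e (q * u).
Proof.
by apply: le_lt_trans; rewrite normrM ler_piMl // ltW.
Qed.

(** The operator samples [g] at finitely many points, so it passes to the limit if they lie in the
    polydisc. Four bounds suffice: the other coordinates arise from these by multiplication by q, a
    contraction. *)
Lemma qdiff_defect_cvg alpha a r s (H : nat -> K -> K -> K -> K) g e x y z :
  (forall x y z, [/\ small e x, small e y & small e z] ->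
     series (fun n => H n x y z) @ \oo --> g x y z) ->
  [/\ small e x, small e (q^-1 * y), small e z & small e (z * powq (r - s))] ->
  series (fun n => qdiff_defect q powq alpha a r s (H n) x y z) @ \oo -->
    qdiff_defect q powq alpha a r s g x y z.
Proof.
move=> Hg [sx sy' sz sz'].
have sy : small e y by rewrite -[y](mulVKf q_neq0) small_qM.
have sz1 : small e (z * powq (1 + r - s)).
  by rewrite -addrA powqD powq1 mulrCA small_qM.
have sz2 : small e (z * powq (2 + r - s)).
  by rewrite -2!addrA powqD powq1 mulrCA small_qM // addrA.
have sq2 : small e (q ^+ 2 * z) by rewrite -mulrA !small_qM.
have sqx := small_qM sx.
rewrite [series _](_ : _ = fun N => qdiff_defect q powq alpha a r s
    (fun x y z => series (fun n => H n x y z) N) x y z); last first.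
  apply/funext => N; rewrite /series /= big_mkord.
  rewrite -[LHS]qdiff_defect_sum; congr (qdiff_defect _ _ _ _ _ _ _ x y z).
  by apply/funext => u; apply/funext => v; apply/funext => w; rewrite big_mkord.
rewrite /qdiff_defect.
apply: cvgB; first by apply: cvgMr; apply: cvgB; apply: Hg.
apply: cvgB; last by apply: cvgMr; apply: cvgB; apply: Hg.
by apply: cvgD; apply: cvgMr; apply: cvgB; apply: Hg.
Qed.

(** These two arguments can leave a polydisc: q^-1 y exceeds y by the factor 1/|q|, and z q^(r-s)
    exceeds z by at most 2 once |q^(r-s) - 1| < 1. *)
Lemma powq_bounded_near0 (e : K) : 0 < e -> exists2 d, 0 < d &
  forall r s y z, [/\ small d r, small d s, small d y & small d z] ->
    small e (q^-1 * y) /\ small e (z * powq (r - s)).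
Proof.
move=> e0; have [c c0 cP] := powq_near1 ltr01.
have q0 : 0 < `|q| by rewrite normr_gt0.
have [d1 d10 [d1c d1q]] :=
  pos_lower_bound (divr_gt0 c0 (ltr0Sn K 1)) (mulr_gt0 e0 q0).
have [d d0 [dd1 d2e]] := pos_lower_bound d10 (divr_gt0 e0 (ltr0Sn K 1)).
exists d => // r s y z [sr ss sy sz]; split.
  rewrite /small normrM normfV mulrC ltr_pdivrMr //.
  exact: lt_le_trans (lt_le_trans sy dd1) d1q.
have : small c (r - s).
  rewrite /small (le_lt_trans (ler_normB _ _)) // [c]splitr ltrD //.
    exact: lt_le_trans (lt_le_trans sr dd1) d1c.
  exact: lt_le_trans (lt_le_trans ss dd1) d1c.
move=> /cP; rewrite /small => lt1.
have powq2 : `|powq (r - s)| <= 2.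
  rewrite -[powq _](subrK 1) (le_trans (ler_normD _ _)) // normr1.
  by apply: (lerD (ltW lt1) (lexx 1)).
rewrite normrM (le_lt_trans (ler_wpM2l _ powq2)) // -ltr_pdivlMr //.
exact: lt_le_trans sz d2e.
Qed.

(** |a q^k| < 1 makes 1 - a q^k nonzero. If q^alpha = - q^k, then |q^alpha - 1| = |q^k + 1| is at
    least 1 - |q|, impossible for alpha near 0; the radius is uniform in k. *)
Lemma step_coef_neq0 : exists2 e, 0 < e & forall alpha a r s k,
  small e alpha -> small e a -> step_coef q powq alpha a r s k != 0.
Proof.
have q10 : 0 < 1 - `|q| by rewrite subr_gt0.
have [c c0 cP] := powq_near1 q10.
have [e e0 [ec e1]] := pos_lower_bound c0 ltr01.
exists e => // alpha a r s k salpha sa.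
rewrite /step_coef !mulf_neq0 ?expf_neq0 ?(powq_neq0 q_neq0 powqD powq1) //;
  last first.
  have : `|a * q ^+ k| < 1.
    rewrite normrM normrX (le_lt_trans _ (lt_le_trans sa e1)) // ler_piMr //.
    by rewrite exprn_ile1 // ltW.
  apply: contraTneq => /eqP; rewrite subr_eq0 => /eqP <-.
  by rewrite normr1 ltxx.
have lt1q := cP _ (smallW ec salpha).
apply/eqP => /eqP; rewrite addr_eq0 => /eqP pq; move: lt1q.
rewrite /small pq -opprD normrN.
suff : 1 - `|q| <= `|q ^+ k + 1| by move=> /le_lt_trans h /h; rewrite ltxx.
case: k {pq} => [|k].
  rewrite expr0 [ `|1 + 1|]ger0_norm ?addr_ge0 // lerBlDr -addrA.
  by rewrite lerDl addr_ge0.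
rewrite [_ + 1]addrC; apply: le_trans (lerB_normD _ _).
by rewrite normr1 lerD2l lerN2 normrX exprS ler_piMr // exprn_ile1 // ltW.
Qed.

Lemma qdiff_expansion_iff f : analytic_at (uncurry7 f) (0 : 'rV[K]_7) ->
  (exists mu : nat -> K -> K -> K -> K -> K,
     near_origin (Ltilde_expansion q powq mu f))
  <-> near_origin (qdiff_eq q powq f).
Proof.
move=> /(analytic_regroup subfamily_cvg)[e1 e10 f_regroup].
split=> [[mu /near_originP[e e0 fL]]|/near_originP[e2 e20 feq]].
  have [d1 d10 d1P] := powq_bounded_near0 e0.
  have [d d0 [dd1 de]] := pos_lower_bound d10 e0.
  apply/near_originP; exists d => // alpha x y a z r s.
  move=> [sal sa sr ss] [sx sy sz].
  apply/qdiff_eqP.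
  have [sy' sz'] := d1P r s y z
    (And4 (smallW dd1 sr) (smallW dd1 ss) (smallW dd1 sy) (smallW dd1 sz)).
  have sp : [/\ small e alpha, small e a, small e r & small e s].
    by split; apply: smallW de _.
  (* Applied term by term, the operator kills every [Ltilde], so the defect of [f] is a limit of
     zeros. *)
  have := @qdiff_defect_cvg alpha a r s
    (fun n x y z => mu n alpha a r s * Ltilde q powq r s n alpha x y z a)
    (fun x y z => f alpha x y a z r s) e x y z
    (fun x y z => fL alpha x y a z r s sp)
    (And4 (smallW de sx) sy' (smallW de sz) sz').
  rewrite [series _](_ : _ = cst 0).
    by move=> /(cvg_unique (@norm_hausdorff _ _) (cvg_cst _)) <-.
  apply/funext => N; rewrite /series /= big1 // => n _.
  by rewrite qdiff_defectZ qdiff_defect_Ltilde // mulr0.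
have [e3 e30 stepP] := step_coef_neq0.
have [c c0 [ce1 ce2]] := pos_lower_bound e10 e20.
have [e e'0 [ec ee3]] := pos_lower_bound c0 e30.
(* The coefficients are found for frozen parameters, with 0 as default outside the polydisc, and
   assembled into functions by choice afterwards. *)
have main alpha a r s : exists mu : nat -> K,
    [/\ small e alpha, small e a, small e r & small e s] ->
    forall x y z, [/\ small e x, small e y & small e z] ->
      series (fun n => mu n * Ltilde q powq r s n alpha x y z a) @ \oo -->
      f alpha x y a z r s.
  have [|nsp] := pselect [/\ small e alpha, small e a, small e r & small e s];
    last by exists (fun=> 0).
  move=> [sal sa sr ss].
  have [|d dP] := f_regroup alpha a r s.
    by split; apply: smallW (le_trans ec ce1) _.
  (* This value reduces to [d n 0 0], the coefficient of x^n. *)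
  exists (fun n => xy_part d n 0 1 0) => _ x y z [sx sy sz].
  suff HL n u v w : xyz_part d n u v w =
      xy_part d n 0 1 0 * Ltilde q powq r s n alpha u v w a.
    under eq_fun => n do rewrite -HL.
    by apply: dP; split; apply: smallW (le_trans ec ce1) _.
  have hom m k t x0 y0 : (k <= m)%N ->
      xy_part d m k (t * x0) (t * y0) = t ^+ (m - k) * xy_part d m k x0 y0.
    move=> lekm; rewrite /xy_part mulr_sumr; apply: eq_bigr => i _.
    have -> : t ^+ (m - k) = t ^+ i * t ^+ (m - k - i).
      by rewrite -exprD subnKC // -ltnS.
    by rewrite !exprMn; ring.
  apply: qdiff_eq_homogeneous => //.
  - by move=> k; apply: stepP; apply: smallW ee3 _.
  - by move=> k t x0 y0; apply: hom.
  - move=> x0 y0; rewrite /xy_part subnn !big_ord_recl !big_ord0 !addr0 /=.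
    by rewrite !expr0.
  move=> {u v w} {x y z sx sy sz} x y z.
  have hom3 m t x0 y0 z0 : xyz_part d m (t * x0) (t * y0) (t * z0) =
      t ^+ m * xyz_part d m x0 y0 z0.
    rewrite /xyz_part mulr_sumr; apply: eq_bigr => k _.
    have lekm : (k <= m)%N by rewrite -ltnS.
    have -> : t ^+ m = t ^+ (m - k) * t ^+ k by rewrite -exprD subnK.
    by rewrite hom // exprMn; ring.
  have defect_hom m t : qdiff_defect q powq alpha a r s (xyz_part d m)
      (t * x) (t * y) (t * z) =
      t * (qdiff_defect q powq alpha a r s (xyz_part d m) x y z * t ^+ m).
    rewrite /qdiff_defect ![_ * (t * _)]mulrCA -![t * z * _]mulrA !hom3.
    by ring.
  (* The point (x, y, z) is arbitrary. [M] bounds all coordinates on which convergence depends, so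
     scaling by t with |t| < c / M brings them within [c]. *)
  pose vs := [:: x; y; z; q^-1 * y; z * powq (r - s)].
  pose M := 1 + \sum_(v <- vs) `|v|.
  have M0 : 0 < M by rewrite ltr_pwDl // sumr_ge0.
  (* Along t(x, y, z) the defect of [f], divided by t, is a power series in t whose coefficients are
     the defects of the homogeneous parts; its sum is zero, so they vanish. *)
  apply: (@power_series_eq0 _ (fun n => qdiff_defect q powq alpha a r s
    (xyz_part d n) x y z) (c / M)) => [|t t0 tM]; first exact: divr_gt0.
  have small_t v : v \in vs -> small c (t * v).
    move=> vvs; have vM : `|v| <= M.
      by rewrite /M (big_rem v) //= addrCA lerDl addr_ge0 // sumr_ge0.
    rewrite /small normrM (le_lt_trans (ler_wpM2l _ vM)) //.
    by rewrite -ltr_pdivlMr.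
  have sx : small c (t * x) by rewrite small_t // !inE eqxx.
  have sy : small c (t * y) by rewrite small_t // !inE eqxx !orbT.
  have sz : small c (t * z) by rewrite small_t // !inE eqxx !orbT.
  have sy' : small c (q^-1 * (t * y)).
    by rewrite mulrCA small_t // !inE eqxx !orbT.
  have sz' : small c (t * z * powq (r - s)).
    by rewrite -mulrA small_t // !inE eqxx !orbT.
  have := @qdiff_defect_cvg alpha a r s (xyz_part d)
    (fun x y z => f alpha x y a z r s) c (t * x) (t * y) (t * z) _
    (And4 sx sy' sz sz').
  have -> : qdiff_defect q powq alpha a r s (fun x y z => f alpha x y a z r s)
      (t * x) (t * y) (t * z) = 0.
    apply/qdiff_eqP; apply: feq; split;
      by [apply: smallW (le_trans ec ce2) _ | apply: smallW ce2 _].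
  move=> cvg0; have {}cvg0 := cvg0 (fun x y z '(And3 sx sy sz) =>
    dP x y z (And3 (smallW ce1 sx) (smallW ce1 sy) (smallW ce1 sz))).
  rewrite -(mulr0 t^-1) [series _](_ : _ = fun N => t^-1 * series (fun n =>
    qdiff_defect q powq alpha a r s (xyz_part d n) (t * x) (t * y) (t * z)) N).
    exact: cvgMr cvg0.
  apply/funext => N; rewrite /series /= mulr_sumr; apply: eq_bigr => m _.
  by rewrite defect_hom mulKf.
have [mu muP] : exists mu : nat -> K -> K -> K -> K -> K, forall alpha a r s,
    [/\ small e alpha, small e a, small e r & small e s] ->
    forall x y z, [/\ small e x, small e y & small e z] ->
    Ltilde_expansion q powq mu f alpha x y a z r s.
  have /choice[mu muP] := fun t : K * K * K * K =>
    main t.1.1.1 t.1.1.2 t.1.2 t.2.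
  exists (fun n alpha a r s => mu (alpha, a, r, s) n) => alpha a r s.
  exact: (muP (alpha, a, r, s)).
exists mu; apply/near_originP; exists e => // alpha x y a z r s sp.
exact: muP.
Qed.
End Expansion.

(** * The complex exponential and the powers of q *)

Section ComplexExponential.
Variable R : realType.
Local Open Scope classical_set_scope.

Lemma cexpD : {morph @cexp R : u v / u + v >-> u * v}.
Proof.
move=> [a b] [c d]; rewrite /cexp /= expRD cosD sinD.
by apply/eqP; rewrite eq_complex /=; apply/andP; split; apply/eqP; ring.
Qed.

Lemma cexp_near1 (e : R[i]) : 0 < e ->
  exists2 d, 0 < d & forall z : R[i], `|z| < d -> `|cexp z - 1| < e.
Proof.
move=> e0; have /complex_realP[t et] : e \is Num.real by rewrite gtr0_real.
move: e0; rewrite {}et ltcR => t0.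
have t20 : 0 < t / 2 by rewrite divr_gt0.
have p1 : {for (0, 0), continuous (fun w : R * R => expR w.1 * cos w.2)}.
  apply: cvgM;
    [apply: (@cvg_comp _ _ _ fst expR) | apply: (@cvg_comp _ _ _ snd cos)].
  - exact: cvg_fst.
  - exact: continuous_expR.
  - exact: cvg_snd.
  - exact: continuous_cos.
have p2 : {for (0, 0), continuous (fun w : R * R => expR w.1 * sin w.2)}.
  apply: cvgM;
    [apply: (@cvg_comp _ _ _ fst expR) | apply: (@cvg_comp _ _ _ snd sin)].
  - exact: cvg_fst.
  - exact: continuous_expR.
  - exact: cvg_snd.
  - exact: continuous_sin.
have near_w : \forall w \near ((0, 0) : R * R),
    `|1 - expR w.1 * cos w.2| < t / 2 /\ `|0 - expR w.1 * sin w.2| < t / 2.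
  near=> w; split; near: w.
    by move/cvgrPdist_lt: p1; rewrite expR0 cos0 mul1r; apply.
  by move/cvgrPdist_lt: p2; rewrite expR0 sin0 mul1r; apply.
have /nbhs_ballP[d /= d0 dP] := near_w.
exists d%:C%C => [|[a b] zd]; first by rewrite ltcR.
have [] : `|1 - expR a * cos b| < t / 2 /\ `|0 - expR a * sin b| < t / 2.
  apply: (dP (a, b)); split; rewrite /ball /= sub0r normrN -ltcR.
    exact: le_lt_trans (normc_ge_Re _) zd.
  exact: le_lt_trans (normc_ge_Im _) zd.
rewrite distrC sub0r normrN => lt1 lt2.
apply: le_lt_trans (normc_le_ReDIm _) _; rewrite /cexp /= ltcR [t]splitr.
by rewrite !(mul0r, addr0, subr0, oppr0) ltrD.
Unshelve. all: by end_near.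
Qed.

Local Notation C := (R[i] : numFieldType).

(** The Cauchy property of a subfamily and completeness supply the hypothesis [subfamily_cvg] of the
    abstract argument. *)
Lemma complex_subfamily_cvg (I : choiceType)
    (u : I -> C) (l : C) (G : pred I) : partial_sum u @ totally --> l ->
  exists l' : C, partial_sum (fun i => u i *+ G i) @ totally --> l'.
Proof.
move=> ul.
have [|l' l'P] := @complex_cauchy_cvg R _ (@totally I)
    (fun A => \sum_(i <- A) u i *+ G i) totally_filter.
  move=> e e0; have [A AP] := unordered_cvg_subfamily_cauchy G ul e0.
  by exists (\sum_(i <- A) u i *+ G i); exists A.
exists l'; apply/unordered_cvgP => e e0.
by have [A _ AP] := l'P e e0; exists A.
Qed.
End ComplexExponential.

Theorem theorem2 (R : realType) (q logq : R[i])
    (q_neq0 : q != 0) (q_lt1 : `|q| < 1) (logqP : cexp logq = q)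
    (f : R[i] -> R[i] -> R[i] -> R[i] -> R[i] -> R[i] -> R[i] -> R[i])
    (f_analytic : analytic_near_origin f) :
  (exists mu : nat -> R[i] -> R[i] -> R[i] -> R[i] -> R[i],
     near_origin (Ltilde_expansion q (cpow logq) mu f))
  <-> near_origin (qdiff_eq q (cpow logq) f).
Proof.
apply: qdiff_expansion_iff => //.
- by move=> u v; rewrite /cpow mulrDl cexpD.
- by rewrite /cpow mul1r.
- move=> e e0; have [d d0 dP] := cexp_near1 e0.
  (* 1 + |log q| is positive and bounds |log q|, which gives |u log q| < d. *)
  have l0 : 0 < 1 + `|logq| by rewrite ltr_pwDl.
  exists (d / (1 + `|logq|)) => [|u su]; first by rewrite divr_gt0.
  apply: dP; rewrite normrM; apply: (@le_lt_trans _ _ (`|u| * (1 + `|logq|))).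
    by rewrite ler_wpM2l // lerDr.
  by rewrite -ltr_pdivlMr.
- by move=> u l G; apply: complex_subfamily_cvg.
exact: nbhs_singleton f_analytic.
Qed.
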